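(* Let $a,b\in\mathbb{C}\setminus\{0\}$ and let $r,s,\alpha$ be integers with $0\le r\le s$ and $\alpha\ge 1$. Let $F=a\,x^{r}y^{s+\alpha}+b\,x^{r+\alpha}y^{s}\in\mathbb{C}[x,y]$, a form of degree $d=r+s+\alpha$. Let $q,j$ be the unique nonnegative integers such that $r=q\alpha+j$ with $0\le j<\alpha$, and set $\delta=r+\alpha-s$. Then the Waring rank $\operatorname{rk}(F)$ is given as follows. (1) If $\delta\le 0$, then $\operatorname{rk}(F)=s+1$. (2) If $\delta>0$, then $$\operatorname{rk}(F)=\begin{cases} s+2 & \text{if } j=0,\ r=s \text{ and } \alpha>1,\\ s+1 & \text{if } j=\delta,\\ r+\alpha+1 & \text{if } j>\delta,\\ r+\alpha-j & \text{otherwise.}\end{cases}$$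
   Context: For a nonzero form (homogeneous polynomial) $F\in\mathbb{C}[x,y]$ of degree $d$, the Waring rank $\operatorname{rk}(F)$ is the least integer $m$ such that there exist linear forms $L_1,\dots,L_m\in\mathbb{C}[x,y]_1$ and scalars $a_1,\dots,a_m\in\mathbb{C}$ with $F=a_1L_1^d+\dots+a_mL_m^d$. *)

(* Defs.v *)
From HB Require Import structures.
From mathcomp Require Import all_boot all_order all_algebra.
From mathcomp Require Import reals complex.
From mathcomp Require Import mpoly.

Set Implicit Arguments.
Unset Strict Implicit.
Unset Printing Implicit Defensive.

Import Order.TTheory GRing.Theory Num.Theory.
Local Open Scope ring_scope.

Definition waring_decomposable (K : fieldType) (F : {mpoly K[2]}) (m : nat) :
    Prop :=
  exists (L : 'I_m -> {mpoly K[2]}) (a : 'I_m -> K),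
    (forall i, L i \is 1.-homog) /\
    (* [msize] is the total degree plus one. *)
    F = \sum_(i < m) a i *: L i ^+ (msize F).-1.

(* The Waring rank as a relation, meant for nonzero homogeneous [F]:
   [m] is the least length of a decomposition of [F]. *)
Definition is_waring_rank (K : fieldType) (F : {mpoly K[2]}) (m : nat) : Prop :=
  waring_decomposable F m /\
  forall k : nat, waring_decomposable F k -> (m <= k)%N.

(* Main.v *)
(** Sylvester's apolarity: if [c_i] is the coefficient of [x^i y^(d-i)] in [F]
    divided by ['C(d, i)], then [F] is a sum of [n] powers of pairwise independent
    linear forms exactly when a squarefree form [\sum_k g_k X^k Y^(n-k)] satisfies
    [\sum_k g_k c_(i+k) = 0] for all [i <= d - n].  Here only [c_r] and
    [c_(r+alpha)] are nonzero, so these equations say that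
    [(1 - rho X^alpha) g] has no term of degree between [n - s] and [r + alpha].
    The coefficients of [g] thus split into geometric progressions of step
    [alpha].  When [n] is too small, the progressions broken at either end vanish
    and [X^2] or [Y^2] divides the form.  For the claimed rank, squarefree
    solutions are built from [P_k = \sum_(t <= k) (rho X^alpha)^t]: the
    homogenization of [P_(q+1)] if [j < delta], times [Y] if [j = delta];
    [X Y P_q] instead if [j = 0], [r = s], [alpha > 1]; and [P_(q+1) + l X^n]
    for generic [l], with [n = s + 1] if [delta <= 0] and [n = r + alpha + 1] if
    [j > delta]. *)

Require Import Defs.
From mathcomp Require Import all_boot all_order all_algebra.
From mathcomp Require Import reals complex separable zify ring.
From mathcomp Require Import mpoly.

Set Implicit Arguments.
Unset Strict Implicit.
Unset Printing Implicit Defensive.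

Import Order.TTheory GRing.Theory Num.Theory.
Local Open Scope ring_scope.

(** * Power sums and apolarity *)

(** [c] stands for the coefficients of a form of degree [d] divided by binomials, so that
    [(u x + v y)^d] becomes [u^i v^(d - i)]. *)
Definition power_sums (K : fieldType) (d : nat) (c : nat -> K) (m : nat) : Prop :=
  exists u v a : 'I_m -> K, forall i, (i <= d)%N ->
    c i = \sum_(l < m) a l * (u l ^+ i * v l ^+ (d - i)).

Definition pairing (K : fieldType) (d : nat) (c : nat -> K) (p : {poly K}) : K :=
  \sum_(k < d.+1) p`_k * c k.

Lemma pairingB (K : fieldType) d (c : nat -> K) p1 p2 :
  pairing d c (p1 - p2) = pairing d c p1 - pairing d c p2.
Proof. by rewrite -sumrB; apply: eq_bigr => k _; rewrite coefB mulrBl. Qed.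

Lemma pairingZ (K : fieldType) d (c : nat -> K) x p :
  pairing d c (x *: p) = x * pairing d c p.
Proof. by rewrite mulr_sumr; apply: eq_bigr => k _; rewrite coefZ mulrA. Qed.

Lemma pairingXn (K : fieldType) d (c : nat -> K) i :
  (i <= d)%N -> pairing d c 'X^i = c i.
Proof.
move=> le_id; rewrite /pairing (bigD1 (Ordinal (le_id : (i < d.+1)%N))) //=.
rewrite coefXn eqxx mul1r big1 ?addr0 // => k /eqP ne_ki.
rewrite coefXn; case: eqP => [eq_ki|_]; last by rewrite mul0r.
by case: ne_ki; apply: val_inj.
Qed.

(* Multiplying the argument of [phi] by ['X - z] removes the root [z], so that
   the induction hypothesis applies to the twisted functional; what remains is
   a geometric progression of ratio [z]. *)
Lemma linear_recurrence_distinct_roots (K : fieldType) (s : seq K)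
    (phi : {poly K} -> K) (D : nat) :
  {morph phi : p1 p2 / p1 - p2} ->
  (forall x p, phi (x *: p) = x * phi p) -> uniq s ->
  (forall i, (i + size s < D)%N ->
     phi ('X^i * \prod_(z <- s) ('X - z%:P)) = 0) ->
  exists w : K -> K, forall i, (i < D)%N ->
    phi 'X^i = \sum_(z <- s) w z * z ^+ i.
Proof.
elim: s phi D => [|z s IHs] phi D phiB phiZ /=.
  move=> _ phi0; exists (fun=> 0) => i lt_iD; rewrite big_nil.
  by rewrite -(phi0 i) ?addn0 // big_nil mulr1.
case/andP=> z_s uniq_s phi0.
case: (IHs (fun p => phi (('X - z%:P) * p)) D.-1) => //.
- by move=> p1 p2; rewrite mulrBr phiB.
- by move=> x p; rewrite -scalerAr phiZ.
- move=> i lt_iD; rewrite mulrCA -[RHS](phi0 i) ?big_cons //; lia.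
(* Undoing the twist divides each weight by [y - z]; [w0] is then fitted to the value at [i = 0]. *)
move=> w wP; pose w' y := w y / (y - z).
pose w0 := phi 1 - \sum_(y <- s) w' y.
exists (fun y => if y == z then w0 else w' y) => i.
rewrite big_cons eqxx.
have -> j : \sum_(y <- s) (if y == z then w0 else w' y) * y ^+ j
   = \sum_(y <- s) w' y * y ^+ j.
  rewrite !big_seq; apply: eq_bigr => y y_s.
  by case: eqP => // eq_yz; rewrite -eq_yz y_s in z_s.
elim: i => [|i IHi] lt_iD.
  by under eq_bigr do rewrite expr0 mulr1; rewrite expr0 mulr1 subrK.
have := wP i; rewrite mulrBl phiB -exprS mul_polyC phiZ => /(_ _)/eqP.
rewrite subr_eq => /(_ _)/eqP -> //; last by lia.
rewrite IHi 1?ltnW // mulrDr addrCA; congr (_ + _).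
  by rewrite exprS; ring.
rewrite mulr_sumr -big_split /= !big_seq; apply: eq_bigr => y y_s.
have : y - z != 0.
  by rewrite subr_eq0; apply: contraNneq z_s => <-.
by rewrite /w' => yz_neq0; rewrite exprS; field.
Qed.

(* [inf] tells whether the point at infinity, i.e. the linear form [x], is
   among the powers used. *)
Lemma power_sums_of_annihilator (K : closedFieldType) d (c : nat -> K)
    (g : {poly K}) (inf : bool) :
  separable_poly g ->
  (forall i, (i + ((size g).-1 + inf) <= d)%N -> pairing d c ('X^i * g) = 0) ->
  power_sums d c ((size g).-1 + inf).
Proof.
move=> sep_g.
have g_neq0 : g != 0 := separable_poly_neq0 sep_g.
have [s g_s] := closed_field_poly_normal g.
have lc_neq0 : lead_coef g != 0 by rewrite lead_coef_eq0.
have uniq_s : uniq s.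
  rewrite -separable_prod_XsubC -(eqp_separable (p := g)) //.
  by rewrite g_s eqp_scale.
have -> : (size g).-1 = size s.
  by rewrite g_s size_scale // size_prod_XsubC.
move=> gP.
case: (linear_recurrence_distinct_roots (phi := pairing d c) (D := d.+1 - inf)
  (@pairingB _ d c) (@pairingZ _ d c) uniq_s).
  move=> i lt_id; have le_id : (i + (size s + inf) <= d)%N.
    by case: (inf) lt_id => /=; lia.
  have := gP i le_id; rewrite {1}g_s -scalerAr pairingZ.
  by move=> /eqP; rewrite mulf_eq0 (negPf lc_neq0) => /eqP.
move=> w wP.
(* Index [size s], reached only when [inf] holds, carries the form [x]. Its power affects [c d]
   alone, and [e] is the error that the recurrence leaves there. *)
pose u l := if (l < size s)%N then s`_l else 1.
pose v l : K := if (l < size s)%N then 1 else 0.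
pose e := c d - \sum_(z <- s) w z * z ^+ d.
pose a l := if (l < size s)%N then w s`_l else e.
exists (fun l => u l), (fun l => v l), (fun l => a l) => i le_id.
have sumE : \sum_(l < size s) a l * (u l ^+ i * v l ^+ (d - i))
    = \sum_(z <- s) w z * z ^+ i.
  rewrite (big_nth 0) big_mkord; apply: eq_bigr => l _.
  by rewrite /a /u /v ltn_ord expr1n mulr1.
case: inf gP wP => _ wP /=.
  rewrite addn1 big_ord_recr /= sumE /a /u /v ltnn expr1n mul1r.
  have [lt_id|ge_id] := ltnP i d.
    by rewrite expr0n subn_eq0 leqNgt lt_id mulr0 addr0 -wP ?pairingXn //; lia.
  have -> : i = d by lia.
  by rewrite subnn expr0 mulr1 /e addrC subrK.
by rewrite addn0 sumE -wP ?pairingXn //; lia.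
Qed.

(* The conditions on the extreme coefficients say that neither [X^2] nor [Y^2]
   divides the form [\sum_k g_k X^k Y^(n - k)]. *)
Lemma annihilator_of_power_sums (K : fieldType) d (c : nat -> K) m :
  power_sums d c m ->
  exists n (g : {poly K}), [/\ (n <= m)%N, (size g <= n.+1)%N,
    (g`_0 != 0) || (g`_1 != 0), (g`_n != 0) || (g`_n.-1 != 0) &
    forall i, (i + n <= d)%N -> pairing d c ('X^i * g) = 0].
Proof.
case=> u [v [a cE]].
(* [undup] merges proportional forms, so [g] has simple roots. The forms with [v l = 0] are all
   multiples of [x] and together account for one factor [Y]. *)
pose s := undup [seq u l / v l | l <- enum 'I_m & v l != 0].
pose inf := has (fun l => v l == 0) (enum 'I_m).
pose g := \prod_(z <- s) ('X - z%:P).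
have size_g : size g = (size s).+1 by rewrite size_prod_XsubC.
have lead_g : g`_(size s) = 1.
  by have /monicP := monic_prod_XsubC s xpredT id; rewrite lead_coefE size_g.
exists (size s + inf)%N, g; split.
- have -> : m = size (enum 'I_m) by rewrite size_enum_ord.
  rewrite -(count_predC (fun l => v l != 0)) leq_add //.
    by rewrite (leq_trans (size_undup _)) // size_map size_filter.
  rewrite /inf has_count; under [X in (_ <= X)%N]eq_count do rewrite /= negbK.
  by case: (count _ _).
- by rewrite size_g ltnS leq_addr.
- rewrite -negb_and; apply/negP => /andP[/eqP g0 /eqP g1].
  have : separable_poly g by rewrite separable_prod_XsubC undup_uniq.
  rewrite unlock => /(@coprimep_root _ _ _ 0).
  by rewrite rootE !horner_coef0 coef_deriv g0 g1 mul0rn eqxx => /(_ isT).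
- by case: inf; rewrite ?addn1 ?addn0 lead_g oner_eq0 ?orbT.
move=> i le_id; pose p := 'X^i * g.
have size_p : size p = (i + (size s).+1)%N.
  by rewrite size_monicM ?monicXn // -?size_poly_eq0 ?size_g // size_polyXn; lia.
transitivity (\sum_(l < m) a l *
    \sum_(k < d.+1) p`_k * (u l ^+ k * v l ^+ (d - k))).
  rewrite /pairing; under eq_bigr => k _ do rewrite cE -1?ltnS // mulr_sumr.
  rewrite exchange_big; apply: eq_bigr => l _ /=; rewrite mulr_sumr.
  by apply: eq_bigr => k _; rewrite mulrCA.
rewrite big1 // => l _; apply/eqP; rewrite mulf_eq0; apply/orP; right.
have [v0|v_neq0] := eqVneq (v l) 0.
  have inf1 : inf by apply/hasP; exists l; rewrite ?mem_enum ?v0.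
  (* Only [k = d] could survive, but with [inf] the bound on [i] keeps the degree of [p] below
     [d]. *)
  rewrite big1 // => k _; rewrite v0 expr0n subn_eq0.
  case: leqP => [le_dk|_]; last by rewrite !mulr0.
  rewrite nth_default ?mul0r //; rewrite size_p; move: le_id; rewrite inf1; lia.
have -> : \sum_(k < d.+1) p`_k * (u l ^+ k * v l ^+ (d - k))
    = v l ^+ d * p.[u l / v l].
  rewrite (@horner_coef_wide _ d.+1) ?size_p; last by lia.
  rewrite mulr_sumr; apply: eq_bigr => k _; rewrite expr_div_n.
  have vk_neq0 : v l ^+ k != 0 by rewrite expf_neq0.
  have -> : v l ^+ d = v l ^+ k * v l ^+ (d - k) by rewrite -exprD subnKC // -ltnS.
  by field.
rewrite hornerM; suff -> : g.[u l / v l] = 0 by rewrite !mulr0.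
apply/eqP; rewrite -rootE root_prod_XsubC mem_undup.
by apply/mapP; exists l; rewrite // mem_filter v_neq0 mem_enum.
Qed.

(** * Binary forms and their normalized coefficients *)

Lemma mdeg_eq1 n (m : 'X_{1..n}) : mdeg m = 1%N -> exists i, m = U_(i)%MM.
Proof.
move=> m1; have /existsP[i mi_neq0] : [exists i, m i != 0%N].
  apply: contraPT m1; rewrite negb_exists => /forallP m0.
  by rewrite mdegE big1 // => i _; apply/eqP/negPn/m0.
exists i; have /submK mE : (U_(i) <= m)%MM by rewrite lep1mP.
move: m1; rewrite -mE mdegD mdeg1 addn1 => -[/eqP].
by rewrite mdeg_eq0 => /eqP ->; rewrite add0m.
Qed.

Lemma mpoly2_linear_form (K : fieldType) (L : {mpoly K[2]}) :
  L \is 1.-homog -> exists u v : K, L = u *: 'X_0 + v *: 'X_1.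
Proof.
move=> /dhomogP homL; exists L@_U_(0%R)%MM, L@_U_(1%R)%MM.
apply/mpolyP => m; rewrite mcoeffD !mcoeffZ !mcoeffX.
have [m_L|m_L] := boolP (m \in msupp L); last first.
  have coefU i : L@_U_(i) * (U_(i)%MM == m)%:R = 0.
    by case: eqP => [->|_]; rewrite ?mulr0 // memN_msupp_eq0 ?mul0r.
  by rewrite memN_msupp_eq0 // !coefU addr0.
have [i ->] := mdeg_eq1 (homL m m_L).
have [->|->] : i = 0 \/ i = 1.
- by case: i => -[|[|]] // ?; [left|right]; apply: val_inj.
- by rewrite eqxx !eq_mnm1 /= mulr1 mulr0 addr0.
- by rewrite eqxx !eq_mnm1 /= mulr1 mulr0 add0r.
Qed.

Definition binary_form (K : fieldType) (d : nat) (c : nat -> K) : {mpoly K[2]} :=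
  \sum_(i < d.+1) (c i *+ 'C(d, i)) *: ('X_0 ^+ i * 'X_1 ^+ (d - i)).

Lemma linear_form_exp (K : fieldType) (u v : K) d :
  (u *: 'X_0 + v *: 'X_1) ^+ d = binary_form d (fun i => u ^+ i * v ^+ (d - i)).
Proof.
rewrite addrC exprDn; apply: eq_bigr => i _.
rewrite !exprZn -scalerAl -scalerAr scalerA scalerMnl.
by rewrite mulrC [X in _ *: X]mulrC.
Qed.

Lemma binary_form_sum (K : fieldType) d m (a : 'I_m -> K) (c : 'I_m -> nat -> K) :
  \sum_(l < m) a l *: binary_form d (c l) =
  binary_form d (fun i => \sum_(l < m) a l * c l i).
Proof.
under eq_bigr do rewrite scaler_sumr; rewrite exchange_big.
apply: eq_bigr => i _; rewrite -sumrMnl scaler_suml; apply: eq_bigr => l _ /=.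
by rewrite scalerA mulrnAr.
Qed.

Lemma eq_binary_form (K : fieldType) d (c1 c2 : nat -> K) :
  (forall i, (i <= d)%N -> c1 i = c2 i) -> binary_form d c1 = binary_form d c2.
Proof. by move=> eq_c; apply: eq_bigr => i _; rewrite eq_c -1?ltnS. Qed.

(** Setting [X_1] to 1 loses nothing in fixed degree [d], and the binomials cancel in characteristic
    zero. *)
Lemma binary_form_inj (K : numFieldType) d (c1 c2 : nat -> K) :
  binary_form d c1 = binary_form d c2 ->
  forall i, (i <= d)%N -> c1 i = c2 i.
Proof.
pose dehom := mmap (@polyC K) (fun k : 'I_2 => if k == 0 then 'X else 1).
have dehomE c : dehom (binary_form d c) = \poly_(i < d.+1) (c i *+ 'C(d, i)).
  rewrite poly_def /dehom raddf_sum; apply: eq_bigr => i _ /=.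
  by rewrite mmapZ rmorphM !rmorphXn /= !mmapX !mmap1U /= expr1n mulr1 mul_polyC.
move=> /(congr1 dehom); rewrite !dehomE => /polyP eqc i le_id.
have := eqc i; rewrite !coef_poly ltnS le_id => /eqP.
rewrite -subr_eq0 -mulrnBl mulrn_eq0 -leqn0 leqNgt bin_gt0 le_id /=.
by rewrite subr_eq0 => /eqP.
Qed.

(** Decompositions take their exponent from [msize], so it has to be identified with [d]. *)
Lemma msize_binary_form (K : numFieldType) d (c : nat -> K) i :
  (i <= d)%N -> c i != 0 -> msize (binary_form d c) = d.+1.
Proof.
move=> le_id ci_neq0; set F := binary_form d c.
have homF : F \is d.-homog.
  apply: rpred_sum => k _; apply: rpredZ.
  have le_kd : (k <= d)%N by rewrite -ltnS.
  have : 'X_0 ^+ k * 'X_1 ^+ (d - k) \is [in K[2], (1 * k + 1 * (d - k)).-homog].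
    by apply: dhomogM; apply: dhomogMn; rewrite dhomogX /= mdeg1.
  by rewrite !mul1n subnKC.
have F_neq0 : F != 0.
  apply: contraNneq ci_neq0 => F0; apply/eqP/(@binary_form_inj _ d _ (fun=> 0)) => //.
  by rewrite -/F F0 /binary_form big1 // => k _; rewrite mul0rn scale0r.
have := dhomog_uniq F_neq0 (dhomog_msize homF) homF.
by case: (msize F) (msize_poly_eq0 F) => [|e _ /= ->] //; rewrite eqxx (negPf F_neq0).
Qed.

Lemma waring_decomposable_binary_form (K : numFieldType) d (c : nat -> K) i m :
  (i <= d)%N -> c i != 0 ->
  waring_decomposable (binary_form d c) m <-> power_sums d c m.
Proof.
move=> le_id ci_neq0.
rewrite /waring_decomposable (msize_binary_form le_id ci_neq0) /=.
split=> [[L [a [homL]]]|[u [v [a cE]]]].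
  have [u uP] : exists u : 'I_m -> K, forall l, exists v, L l = u l *: 'X_0 + v *: 'X_1.
    exact: (fin_all_exists (fun l => mpoly2_linear_form (homL l))).
  have [v LE] := fin_all_exists uP.
  under eq_bigr do rewrite LE linear_form_exp.
  by rewrite binary_form_sum => /binary_form_inj cE; exists u, v, a.
exists (fun l => u l *: 'X_0 + v l *: 'X_1), a; split=> [l|].
  by rewrite rpredD // rpredZ // dhomogX /= mdeg1.
under eq_bigr do rewrite linear_form_exp.
by rewrite binary_form_sum; apply: eq_binary_form.
Qed.

(** * The apolarity equations of a two-term form *)

(* Writing [g = \sum_k g_k X^k], the form [\sum_k g_k X^k Y^(n - k)] annihilates
   [a x^r y^(s + alpha) + b x^(r + alpha) y^s] exactly when this recurrence with
   step [alpha] and ratio [rho = - c_r / c_(r + alpha)] holds, where [c_i] is the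
   coefficient of [x^i] divided by ['C(r + s + alpha, i)]. *)
Definition apolar (K : fieldType) (r s alpha : nat) (rho : K) (n : nat)
    (g : {poly K}) : Prop :=
  forall m, (m <= r + alpha)%N -> (n <= s + m)%N ->
    ((1 - rho *: 'X^alpha) * g)`_m = 0.

Lemma coef_twist (K : fieldType) (rho : K) alpha (g : {poly K}) m :
  ((1 - rho *: 'X^alpha) * g)`_m =
  g`_m - (if (m < alpha)%N then 0 else rho * g`_(m - alpha)).
Proof.
rewrite mulrBl mul1r coefB -scalerAl coefZ coefXnM.
by case: ifP => _; rewrite ?mulr0.
Qed.

Definition two_term (K : fieldType) (r alpha : nat) (x y : K) (i : nat) : K :=
  if i == r then x else if i == (r + alpha)%N then y else 0.

Lemma pairing_two_term (K : fieldType) r s alpha (x y : K) p :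
  (0 < alpha)%N -> y != 0 ->
  pairing (r + s + alpha) (two_term r alpha x y) p =
  y * ((1 - (- x / y) *: 'X^alpha) * p)`_(r + alpha).
Proof.
move=> alpha_gt0 y_neq0; rewrite coef_twist ltnNge leq_addl addnK /=.
have lt_r : (r < (r + s + alpha).+1)%N by lia.
have lt_ra : (r + alpha < (r + s + alpha).+1)%N by lia.
have ne_r : (r + alpha == r)%N = false by lia.
rewrite /pairing (bigD1 (Ordinal lt_r)) // (bigD1 (Ordinal lt_ra)) /=; last first.
  by apply/eqP => /(congr1 val) /= /eqP; rewrite ne_r.
rewrite /two_term !eqxx ne_r big1 => [|k]; first by field.
rewrite -!val_eqE /= => /andP[/negPf -> /negPf ->].
by rewrite mulr0.
Qed.

(** Multiplying [g] by [X^i] moves the equation in degree [r + alpha] to [m = r + alpha - i]; for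
    [i > r + alpha] it is trivial. *)
Lemma apolar_pairing (K : fieldType) r s alpha (x y : K) n g :
  (0 < alpha)%N -> y != 0 ->
  apolar r s alpha (- x / y) n g <->
  (forall i, (i + n <= r + s + alpha)%N ->
     pairing (r + s + alpha) (two_term r alpha x y) ('X^i * g) = 0).
Proof.
move=> alpha_gt0 y_neq0; split=> [gP i le_in|gP m le_m le_n].
  rewrite pairing_two_term // mulrCA coefXnM; case: ltnP => [_|le_i].
    by rewrite mulr0.
  by rewrite gP ?mulr0 //; lia.
have := gP (r + alpha - m)%N; rewrite pairing_two_term // mulrCA coefXnM.
rewrite ltnNge leq_subr subKn //= => /(_ _)/eqP.
by rewrite mulf_eq0 (negPf y_neq0) => /(_ _)/eqP -> //; lia.
Qed.

(** * Lower bounds from broken geometric progressions *)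

(** Below [alpha] the recurrence has no preceding term, so it forces [g_e = 0], which propagates
    upwards in steps of [alpha]. *)
Lemma apolar_start (K : fieldType) (r s alpha : nat) (rho : K)
    (n : nat) (g : {poly K}) e t :
  apolar r s alpha rho n g ->
  (e < alpha)%N -> (n <= s + e)%N ->
  (e + t * alpha <= r + alpha)%N -> g`_(e + t * alpha) = 0.
Proof.
move=> gP lt_e le_n; elim: t => [|t IHt] le_m.
  rewrite mul0n addn0; have := gP e; rewrite coef_twist lt_e subr0.
  by apply; lia.
have := gP _ le_m; rewrite coef_twist.
have -> : (e + t.+1 * alpha = e + t * alpha + alpha)%N by lia.
rewrite ltnNge leq_addl addnK /= IHt ?mulr0 ?subr0; last by lia.
by apply; lia.
Qed.

(** Downward propagation: the progression of [e] runs past the degree bound [n], where coefficients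
    are zero, and [rho] can be cancelled. *)
Lemma apolar_end (K : fieldType) (r s alpha : nat) (rho : K)
    (n : nat) (g : {poly K}) e t :
  rho != 0 -> (size g <= n.+1)%N -> apolar r s alpha rho n g ->
  (n < e + t * alpha)%N -> (n <= s + alpha + e)%N ->
  (e + t * alpha <= r + alpha)%N -> g`_e = 0.
Proof.
move=> rho_neq0 size_g gP; elim: t e => [|t IHt] e lt_n le_n le_m.
  by rewrite nth_default // (leq_trans size_g) //; lia.
have ge0 : g`_(e + alpha) = 0 by apply: IHt; lia.
have := gP (e + alpha)%N; rewrite coef_twist ge0 ltnNge leq_addl addnK.
rewrite sub0r /= => /(_ _ _)/eqP; rewrite oppr_eq0 mulf_eq0 (negPf rho_neq0).
by move=> /(_ _ _)/eqP -> //; lia.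
Qed.

Lemma apolar_gt_s (K : fieldType) (r s alpha : nat) (rho : K)
    (n : nat) (g : {poly K}) :
  (0 < alpha)%N -> apolar r s alpha rho n g -> (g`_0 != 0) || (g`_1 != 0) ->
  (s < n)%N.
Proof.
move=> alpha_gt0 gP; rewrite ltnNge; apply: contraTN => le_ns.
have -> : g`_0 = 0 by apply: (apolar_start (e := 0) (t := 0) gP); lia.
suff -> : g`_1 = 0 by rewrite eqxx.
(* For [alpha = 1], index 1 is the second term of the progression from 0. *)
have [alpha1|alpha_gt1] := leqP alpha 1.
  have -> : 1%N = (0 + 1 * alpha)%N by lia.
  by apply: (apolar_start gP); lia.
by apply: (apolar_start (e := 1) (t := 0) gP); lia.
Qed.

(** The case [j > delta]. If [n <= r + alpha], both top coefficients lie on progressions whose first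
    index is at least [n - s], so [Y^2] would divide the form. *)
Lemma apolar_gt_ra (K : fieldType) (r s alpha q j : nat) (rho : K)
    (n : nat) (g : {poly K}) :
  r = (q * alpha + j)%N -> (j < alpha)%N -> apolar r s alpha rho n g ->
  (g`_0 != 0) || (g`_1 != 0) -> (g`_n != 0) || (g`_n.-1 != 0) ->
  (r + alpha < s + j)%N -> (r + alpha < n)%N.
Proof.
move=> rE lt_j gP low high lt_rasj.
have lt_sn : (s < n)%N by apply: apolar_gt_s gP low; lia.
rewrite ltnNge; apply/negP => le_nra; move: high.
have top e : (e <= 1)%N -> g`_(n - e) = 0.
  move=> le_e1.
  have -> : (n - e = (n + j - e - r - alpha) + q.+1 * alpha)%N by lia.
  by apply: (apolar_start gP); lia.
by rewrite -subn1 -{1}[n]subn0 !top // eqxx.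
Qed.

(** The case [j < delta]. As [r + alpha - j = (q + 1) alpha] exceeds [n], the progression of 0
    overflows and [g_0 = 0]. Then [g_1] survives only if [j = 0], the top coefficients only if
    [r = s], and [g_1] again only if [n >= s + 2]. *)
Lemma apolar_ge_raj (K : fieldType) (r s alpha q j : nat) (rho : K)
    (n : nat) (g : {poly K}) :
  rho != 0 -> (r <= s)%N -> r = (q * alpha + j)%N -> (j < alpha)%N ->
  (size g <= n.+1)%N -> apolar r s alpha rho n g ->
  (g`_0 != 0) || (g`_1 != 0) -> (g`_n != 0) || (g`_n.-1 != 0) ->
  (s + j < r + alpha)%N -> (n < r + alpha - j)%N ->
  [/\ j = 0%N, r = s, (1 < alpha)%N & (s + 2 <= n)%N].
Proof.
move=> rho_neq0 le_rs rE lt_j size_g gP low high lt_sjra lt_n.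
have lt_sn : (s < n)%N by apply: apolar_gt_s gP low; lia.
have g0 : g`_0 = 0 by apply: (apolar_end (t := q.+1) rho_neq0 size_g gP); lia.
have g1 : g`_1 != 0 by move: low; rewrite g0 eqxx.
have j0 : j = 0%N.
  apply/eqP; apply: contraNT g1; rewrite -lt0n => j_gt0.
  by apply/eqP/(apolar_end (t := q.+1) rho_neq0 size_g gP); lia.
have alpha_gt1 : (1 < alpha)%N by lia.
split=> //.
  apply/eqP; rewrite eqn_leq le_rs leqNgt; apply/negP => lt_rs; move: high.
  have top e : (e <= 1)%N -> g`_(n - e) = 0.
    move=> le_e1; have -> : (n - e = (n - e - r) + q * alpha)%N by lia.
    by apply: (apolar_start gP); lia.
  by rewrite -subn1 -{1}[n]subn0 !top // eqxx.
rewrite leqNgt; apply: contraNN g1 => lt_n2.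
by apply/eqP/(apolar_start (e := 1) (t := 0) gP); lia.
Qed.

(** * Separable polynomials for the upper bounds *)

Definition geom (K : fieldType) (alpha : nat) (rho : K) (q : nat) : {poly K} :=
  \sum_(t < q.+1) (rho *: 'X^alpha) ^+ t.

Lemma geomE (K : fieldType) alpha (rho : K) q :
  (1 - rho *: 'X^alpha) * geom alpha rho q = 1 - rho ^+ q.+1 *: 'X^(q.+1 * alpha).
Proof. by rewrite -opprB mulNr -subrX1 opprB exprZn -exprM mulnC. Qed.

Lemma size_1BZXn (K : fieldType) (x : K) m :
  x != 0 -> (0 < m)%N -> size (1 - x *: 'X^m) = m.+1.
Proof.
move=> x_neq0 m_gt0; rewrite -size_polyN opprB size_polyDl.
  by rewrite size_scale // size_polyXn.
by rewrite size_polyN size_poly1 size_scale // size_polyXn.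
Qed.

Lemma geom0 (K : fieldType) alpha (rho : K) q :
  (0 < alpha)%N -> (geom alpha rho q).[0] = 1.
Proof.
move=> alpha_gt0; have := congr1 (horner^~ 0) (geomE alpha rho q).
by rewrite !hornerE !expr0n muln_eq0 /= eqn0Ngt alpha_gt0 /= !mulr0 !subr0 mul1r.
Qed.

Lemma size_geom (K : fieldType) alpha (rho : K) q :
  (0 < alpha)%N -> rho != 0 -> size (geom alpha rho q) = (q * alpha).+1.
Proof.
move=> alpha_gt0 rho_neq0; have := congr1 (size \o polyseq) (geomE alpha rho q).
have geom_neq0 : geom alpha rho q != 0.
  by apply/eqP => geom_eq0; have /eqP := geom0 rho q alpha_gt0;
    rewrite geom_eq0 horner0 eq_sym oner_eq0.
have m_gt0 : (0 < q.+1 * alpha)%N by rewrite muln_gt0.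
have size_l := size_1BZXn rho_neq0 alpha_gt0.
have size_r := size_1BZXn (expf_neq0 q.+1 rho_neq0) m_gt0.
rewrite /= size_r size_mul ?size_l //; first by rewrite mulSn addSn /= -addnS => /addnI.
by rewrite -size_poly_eq0 size_l.
Qed.

Lemma separable_of_simple_roots (K : closedFieldType) (p : {poly K}) :
  (forall x, root p x -> p^`().[x] != 0) -> separable_poly p.
Proof. by rewrite unlock; apply: Pdiv.ClosedField.root_coprimep. Qed.

(** By [geomE], a double root is also one of [1 - rho^(q + 1) X^((q + 1) alpha)], whose derivative
    vanishes at most at 0, where [geom] is 1. *)
Lemma separable_geom (K : numClosedFieldType) alpha (rho : K) q :
  (0 < alpha)%N -> rho != 0 -> separable_poly (geom alpha rho q).
Proof.
move=> alpha_gt0 rho_neq0; apply: separable_of_simple_roots => x.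
rewrite rootE => /eqP gx0; apply/eqP => g'x0.
have := congr1 (fun p => p^`().[x]) (geomE alpha rho q).
rewrite derivM !hornerE gx0 g'x0 mulr0 mulr0 addr0 derivB derivZ derivXn derivC.
rewrite !hornerE hornerMn ?hornerXn => /esym/eqP.
have m_gt0 : (0 < q.+1 * alpha)%N by rewrite muln_gt0.
rewrite oppr_eq0 mulf_eq0 (negPf (expf_neq0 _ rho_neq0)) mulrn_eq0 /=.
rewrite eqn0Ngt m_gt0 expf_eq0 /= => /andP[_ /eqP x0].
by move/eqP: gx0; rewrite x0 geom0 // oner_eq0.
Qed.

(* A root common to [p + l x^n] and its derivative is a root of
   [n p - x p'], which does not depend on [l], and it determines [l]. *)
Lemma separable_perturbation (K : numClosedFieldType) (p : {poly K}) n :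
  (0 < n)%N -> p.[0] != 0 ->
  exists2 l, l != 0 & separable_poly (p + l *: 'X^n).
Proof.
move=> n_gt0 p0; pose w := p *+ n - 'X * p^`().
have w_neq0 : w != 0.
  apply/eqP => /(congr1 (horner^~ 0));
  rewrite hornerD hornerN hornerM hornerX hornerMn mul0r subr0 horner0.
  by move/eqP; rewrite mulrn_eq0 eqn0Ngt n_gt0 (negPf p0).
have [ws wE] := closed_field_poly_normal w.
(* A common root [x] would force [l = - p(x) / x^n]; 0 is listed to keep [l] nonzero. *)
pose bad := 0 :: [seq - p.[x] / x ^+ n | x <- ws].
have [l l_bad] : exists l, l \notin bad.
  have /closed_nonrootP[l] : \prod_(z <- bad) ('X - z%:P) != 0.
    by rewrite monic_neq0 // monic_prod_XsubC.
  by rewrite root_prod_XsubC => l_bad; exists l.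
move: l_bad; rewrite inE negb_or => /andP[l_neq0 l_bad].
exists l => //; apply: separable_of_simple_roots => x.
rewrite rootE !hornerE => /eqP px0; apply/eqP.
rewrite derivD derivZ derivXn !hornerE hornerMn ?hornerXn => p'x0.
have x_neq0 : x != 0.
  apply: contraNneq p0 => x0; move/eqP: px0.
  by rewrite x0 expr0n eqn0Ngt n_gt0 mulr0 addr0.
have : root w x.
  rewrite rootE hornerD hornerN hornerM hornerX hornerMn.
  have -> : p^`().[x] = - (l * (x ^+ n.-1 *+ n)).
    by apply/eqP; rewrite -addr_eq0 p'x0.
  have -> : p.[x] = - (l * x ^+ n) by apply/eqP; rewrite -addr_eq0 px0.
  have -> : x ^+ n = x * x ^+ n.-1 by rewrite -exprS prednK.
  by rewrite mulNrn !(mulrnAr, mulrN) opprK addrC subr_eq0 mulrCA.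
rewrite wE rootZ ?lead_coef_eq0 // root_prod_XsubC => x_ws.
case/negP: l_bad; apply/mapP; exists x => //.
have -> : p.[x] = - (l * x ^+ n) by apply/eqP; rewrite -addr_eq0 px0.
by rewrite opprK mulfK // expf_neq0.
Qed.

(** * Upper bounds from explicit annihilators *)

Lemma power_sums_of_apolar (K : numClosedFieldType) (r s alpha : nat) (x y : K)
    (g : {poly K}) (inf : bool) n :
  y != 0 -> (0 < alpha)%N -> separable_poly g -> ((size g).-1 + inf = n)%N ->
  apolar r s alpha (- x / y) n g ->
  power_sums (r + s + alpha) (two_term r alpha x y) n.
Proof.
move=> y_neq0 alpha_gt0 sep_g <- gP; apply: power_sums_of_annihilator => // i.
exact: ((@apolar_pairing K r s alpha x y _ g alpha_gt0 y_neq0).1 gP i).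
Qed.

(** The product telescopes to terms of degree 0 and [(q + 2) alpha], while the equations concern [0
    < n - s <= m <= r + alpha < (q + 2) alpha]. *)
Lemma apolar_geom (K : fieldType) (r s alpha q j : nat) (rho : K) n :
  r = (q * alpha + j)%N -> (j < alpha)%N -> (s < n)%N ->
  apolar r s alpha rho n (geom alpha rho q.+1).
Proof.
move=> rE lt_j lt_sn m le_m le_n; rewrite geomE coefB coefZ coefXn coef1.
have -> : (m == 0)%N = false by lia.
have -> : (m == q.+2 * alpha)%N = false by lia.
by rewrite mulr0 subr0.
Qed.

(** Here [geom] has degree [(q + 1) alpha = r + alpha - j = s], and the factor [Y], encoded by
    [inf], raises it to [s + 1]. *)
Lemma power_sums_eq (K : numClosedFieldType) (r s alpha q j : nat) (x y : K) :
  x != 0 -> y != 0 -> r = (q * alpha + j)%N -> (j < alpha)%N ->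
  (r + alpha = s + j)%N ->
  power_sums (r + s + alpha) (two_term r alpha x y) s.+1.
Proof.
move=> x_neq0 y_neq0 rE lt_j eq_sj.
have alpha_gt0 : (0 < alpha)%N by lia.
have rho_neq0 : - x / y != 0 by rewrite mulf_neq0 ?invr_eq0 ?oppr_eq0.
apply: (power_sums_of_apolar (g := geom alpha (- x / y) q.+1) (inf := true)
  y_neq0 alpha_gt0).
- exact: separable_geom.
- by rewrite size_geom //; lia.
- exact: apolar_geom rE lt_j _.
Qed.

Lemma power_sums_lt (K : numClosedFieldType) (r s alpha q j : nat) (x y : K) :
  x != 0 -> y != 0 -> r = (q * alpha + j)%N -> (j < alpha)%N ->
  (s + j < r + alpha)%N ->
  power_sums (r + s + alpha) (two_term r alpha x y) (r + alpha - j).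
Proof.
move=> x_neq0 y_neq0 rE lt_j lt_sj.
have alpha_gt0 : (0 < alpha)%N by lia.
have rho_neq0 : - x / y != 0 by rewrite mulf_neq0 ?invr_eq0 ?oppr_eq0.
apply: (power_sums_of_apolar (g := geom alpha (- x / y) q.+1) (inf := false)
  y_neq0 alpha_gt0).
- exact: separable_geom.
- by rewrite size_geom //; lia.
- by apply: apolar_geom rE lt_j _; lia.
Qed.

Lemma power_sums_special (K : numClosedFieldType) (r s alpha q j : nat) (x y : K) :
  x != 0 -> y != 0 -> r = (q * alpha + j)%N -> (j < alpha)%N ->
  j = 0%N -> r = s ->
  power_sums (r + s + alpha) (two_term r alpha x y) s.+2.
Proof.
move=> x_neq0 y_neq0 rE lt_j j0 eq_rs.
have alpha_gt0 : (0 < alpha)%N by lia.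
have rho_neq0 : - x / y != 0 by rewrite mulf_neq0 ?invr_eq0 ?oppr_eq0.
apply: (power_sums_of_apolar (g := geom alpha (- x / y) q * 'X) (inf := true)
  y_neq0 alpha_gt0).
- rewrite -['X]subr0 -polyC0 separable_root separable_geom //.
  by rewrite rootE geom0 // oner_eq0.
- rewrite size_mulX ?size_geom //; first by lia.
  by rewrite -size_poly_eq0 size_geom.
(* The surviving terms have degree 1 and [(q + 1) alpha + 1 = r + alpha + 1], just outside the range
   [2 <= m <= r + alpha]. *)
move=> m le_m le_n; rewrite mulrA geomE coefMX coefB coefZ coefXn coef1.
have -> : (m == 0)%N = false by lia.
have -> : (m.-1 == 0)%N = false by lia.
have -> : (m.-1 == q.+1 * alpha)%N = false by lia.
by rewrite mulr0 subr0.
Qed.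

(** The summand [l X^n] brings the degree up to [n] and, as [n > r + alpha], stays beyond every
    equation. *)
Lemma power_sums_generic (K : numClosedFieldType) (r s alpha q j : nat) (x y : K) n :
  x != 0 -> y != 0 -> r = (q * alpha + j)%N -> (j < alpha)%N ->
  (s < n)%N -> (r + alpha < n)%N ->
  power_sums (r + s + alpha) (two_term r alpha x y) n.
Proof.
move=> x_neq0 y_neq0 rE lt_j lt_sn lt_ran.
have alpha_gt0 : (0 < alpha)%N by lia.
have rho_neq0 : - x / y != 0 by rewrite mulf_neq0 ?invr_eq0 ?oppr_eq0.
have [l l_neq0 sep_g] : exists2 l, l != 0 &
    separable_poly (geom alpha (- x / y) q.+1 + l *: 'X^n).
  by apply: separable_perturbation; rewrite ?geom0 ?oner_eq0 //; lia.
apply: (power_sums_of_apolar (inf := false) y_neq0 alpha_gt0 sep_g).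
  rewrite addrC size_polyDl size_scale // size_polyXn /= ?addn0 //.
  by rewrite size_geom //; lia.
move=> m le_m le_n; rewrite mulrDr coefD (apolar_geom _ rE lt_j lt_sn) // add0r.
by rewrite -scalerAr coefZ coefMXn ifT ?mulr0 //; lia.
Qed.

(** * The rank of the two-term form *)

Lemma binary_form_two_term (K : numFieldType) r s alpha (a b : K) :
  (0 < alpha)%N ->
  a *: ('X_0 ^+ r * 'X_1 ^+ (s + alpha)) + b *: ('X_0 ^+ (r + alpha) * 'X_1 ^+ s)
  = binary_form (r + s + alpha) (two_term r alpha
      (a / 'C(r + s + alpha, r)%:R) (b / 'C(r + s + alpha, r + alpha)%:R)).
Proof.
move=> alpha_gt0; set d := (r + s + alpha)%N.
have lt_r : (r < d.+1)%N by rewrite /d; lia.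
have lt_ra : (r + alpha < d.+1)%N by rewrite /d; lia.
have ne_r : (r + alpha == r)%N = false by lia.
have bin_neq0 k : (k < d.+1)%N -> 'C(d, k)%:R != 0 :> K.
  by move=> lt_k; rewrite pnatr_eq0 -lt0n bin_gt0.
rewrite /binary_form (bigD1 (Ordinal lt_r)) // (bigD1 (Ordinal lt_ra)) /=; last first.
  by apply/eqP => /(congr1 val) /= /eqP; rewrite ne_r.
rewrite /two_term !eqxx ne_r big1 => [|k]; last first.
  rewrite -!val_eqE /= => /andP[/negPf -> /negPf ->].
  by rewrite mul0rn scale0r.
rewrite -(mulr_natr (a / _)) -(mulr_natr (b / _)) !divfK ?bin_neq0 // addr0.
by congr (_ *: (_ * _ ^+ _) + _ *: (_ * _ ^+ _)); rewrite /d; lia.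
Qed.

Theorem theorem3p1 (R : realType) (a b : R[i]) (r s alpha q j : nat)
    (delta : int) (F : {mpoly R[i][2]})
    (ha : a != 0) (hb : b != 0)
    (hrs : (r <= s)%N) (halpha : (1 <= alpha)%N)
    (hF : F = a *: ('X_0 ^+ r * 'X_1 ^+ (s + alpha))
            + b *: ('X_0 ^+ (r + alpha) * 'X_1 ^+ s))
    (hr : r = (q * alpha + j)%N) (hj : (j < alpha)%N)
    (hdelta : delta = r%:Z + alpha%:Z - s%:Z) :
  (delta <= 0 -> is_waring_rank F (s + 1)%N) /\
  (0 < delta ->
     is_waring_rank F
       (if [&& j == 0%N, r == s & (1 < alpha)%N] then (s + 2)%N
        else if j%:Z == delta then (s + 1)%N
        else if delta < j%:Z then (r + alpha + 1)%N
        else (r + alpha - j)%N)).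
Proof.
pose d := (r + s + alpha)%N.
pose x := a / 'C(d, r)%:R; pose y := b / 'C(d, r + alpha)%:R.
have bin_neq0 k : (k <= d)%N -> 'C(d, k)%:R != 0 :> R[i].
  by move=> le_k; rewrite pnatr_eq0 -lt0n bin_gt0.
have x_neq0 : x != 0 by rewrite mulf_neq0 ?invr_eq0 ?bin_neq0 // /d; lia.
have y_neq0 : y != 0 by rewrite mulf_neq0 ?invr_eq0 ?bin_neq0 // /d; lia.
have decP m : waring_decomposable F m <-> power_sums d (two_term r alpha x y) m.
  rewrite hF binary_form_two_term //.
  apply: (@waring_decomposable_binary_form _ _ _ r); first by lia.
  by rewrite /two_term eqxx.
have lower m : waring_decomposable F m -> exists n (g : {poly R[i]}),
    [/\ (n <= m)%N, (size g <= n.+1)%N, (g`_0 != 0) || (g`_1 != 0),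
        (g`_n != 0) || (g`_n.-1 != 0) & apolar r s alpha (- x / y) n g].
  case/decP/annihilator_of_power_sums => n [g [le_nm size_g low high gP]].
  by exists n, g; split=> //; apply/apolar_pairing.
have rho_neq0 : - x / y != 0 by rewrite mulf_neq0 ?invr_eq0 ?oppr_eq0.
split=> [delta_le0 | delta_gt0].
  split=> [|k /lower[n [g [le_nk size_g low high gP]]]].
    by apply/decP; apply: power_sums_generic x_neq0 y_neq0 hr hj _ _; lia.
  have := apolar_gt_s halpha gP low; lia.
case: ifP => [/and3P[/eqP j0 /eqP eq_rs alpha_gt1] | not_special].
  split=> [|k /lower[n [g [le_nk size_g low high gP]]]].
    by apply/decP; rewrite addn2; apply: power_sums_special x_neq0 y_neq0 hr hj _ _.
  (* Here [r + alpha - j = s + alpha >= s + 2], so only smaller [n] need the exceptional bound. *)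
  have [lt_n|] := ltnP n (r + alpha - j); last by lia.
  have lt_sj : (s + j < r + alpha)%N by lia.
  have [_ _ _] := apolar_ge_raj rho_neq0 hrs hr hj size_g gP low high lt_sj lt_n.
  lia.
case: ifP => [/eqP eq_j | ne_j].
  split=> [|k /lower[n [g [le_nk size_g low high gP]]]].
    by apply/decP; rewrite addn1; apply: power_sums_eq x_neq0 y_neq0 hr hj _; lia.
  have := apolar_gt_s halpha gP low; lia.
case: ifP => [gt_j | le_j].
  split=> [|k /lower[n [g [le_nk size_g low high gP]]]].
    by apply/decP; apply: power_sums_generic x_neq0 y_neq0 hr hj _ _; lia.
  have := apolar_gt_ra hr hj gP low high; lia.
split=> [|k /lower[n [g [le_nk size_g low high gP]]]].
  by apply/decP; apply: power_sums_lt x_neq0 y_neq0 hr hj _; lia.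
(* A shorter decomposition would force the exceptional case, excluded by [not_special]. *)
rewrite leqNgt; apply/negP => lt_k.
have lt_sj : (s + j < r + alpha)%N by lia.
have lt_n : (n < r + alpha - j)%N by lia.
have [j0 eq_rs alpha_gt1 _] :=
  apolar_ge_raj rho_neq0 hrs hr hj size_g gP low high lt_sj lt_n.
by move: not_special; rewrite j0 eq_rs alpha_gt1 !eqxx.
Qed.
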